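(* Let $\mathrm{Cl}_V(B)$ be a Clifford algebra over $B$. Then $\mathrm{Cl}_V(B)$ (with the injection $V\subset \mathrm{Cl}_V(B)$) is universal in $\mathcal{A}_R(V,B)$.
   Context: Setting: $R$ is a commutative ring with unit $1\neq 0$; $V\neq\{0\}$ is a free unitary $R$-module with basis $(e_i\mid i\in M)$, where $M$ (possibly infinite) is totally ordered by $<$; $B:V\times V\to R$ is a bilinear form which is diagonal in this basis, i.e. $B(e_i,e_j)=0$ for $i\ne j$; and $q(i)=B(e_i,e_i)$. $\mathcal{F}$ is the set of finite subsets of $M$, and $W=\bigoplus_{\mathcal{F}}R$ is the free $R$-module with basis $(e_K\mid K\in\mathcal{F})$. $V$ is regarded as a submodule of $W$ by identifying $e_i$ with $e_{\{i\}}$. $H\triangle J=(H\cup J)\setminus(H\cap J)$. For $H,J\in\mathcal{F}$: $\alpha(H,J)=\prod(-1)$ over all $(i,j)\in H\times J$ with $j<i$; $\beta(H,J)=\prod_{i\in H\cap J}q(i)$; $\sigma(H,J)=\alpha(H,J)\,\beta(H,J)$ (empty products equal $1$). $W_B=W$ is the associative unital $R$-algebra with unit $e_\emptyset$ whose product is the bilinear extension of $e_He_J=\sigma(H,J)\,e_{H\triangle J}$. An algebra is an $R$-module with an $R$-bilinear associative composition having a unit $1_A$; algebra morphisms map unit to unit. A Clifford algebra over $B$, denoted $\mathrm{Cl}_V(B)$, is an algebra (containing $V$) isomorphic to $W_B$ with an isomorphism fixing $V$. $\mathcal{A}_R(V,B)$ is the category of linear mappings $f$ from $V$ into an $R$-algebra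 $A$ such that $f(x)^2=B(x,x)1_A$ for all $x\in V$. A mapping $\rho:V\to U$ in $\mathcal{A}_R(V,B)$ is universal if for every linear mapping $f:V\to A$ in $\mathcal{A}_R(V,B)$ there is a unique algebra morphism $F:U\to A$ such that $F\circ\rho=f$. When $V\subset U$, $\rho$ is taken to be the injection, so this says that $F$ extends $f$. *)

(* Defs.v *)
(* {malg R[K]} is the free R-module on K (finitely supported functions K -> R),
   with basis << k >>, k : K.                                                *)
From HB Require Import structures.
From mathcomp Require Import all_boot all_order ssralg sesquilinear.
From mathcomp Require Import finmap.
From mathcomp Require Import monalg.

Set Implicit Arguments.
Unset Strict Implicit.
Unset Printing Implicit Defensive.

Import Order.TTheory GRing.Theory.
Local Open Scope fset_scope.
Local Open Scope ring_scope.

Section FreeModule.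
Context (R : nzRingType) (V : lmodType R) (M : choiceType) (e : M -> V).

Definition lincomb (c : {malg R[M]}) : V := \sum_(i <- msupp c) c@_i *: e i.

Definition is_basis : Prop :=
  (forall v, exists c, v == lincomb c) /\
  (forall c, lincomb c = 0 -> c = 0).

Definition coord (he : is_basis) (v : V) : {malg R[M]} := xchoose (he.1 v).

Lemma lincombEw (D : {fset M}) c : msupp c `<=` D ->
  lincomb c = \sum_(i <- D) c@_i *: e i.
Proof.
move=> le; rewrite /lincomb [LHS](big_fset_incl _ le) => //= i _.
by move/mcoeff_outdom->; rewrite scale0r.
Qed.

Lemma lincomb_is_linear : linear lincomb.
Proof.
move=> a c1 c2; set D := msupp c1 `|` msupp c2.
have l1 : msupp c1 `<=` D by apply: fsubsetUl.
have l2 : msupp c2 `<=` D by apply: fsubsetUr.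
have l3 : msupp (a *: c1 + c2) `<=` D.
  by apply: fsubset_trans (msuppD_le _ _) _; rewrite fsetSU // msuppZ_le.
rewrite (lincombEw l1) (lincombEw l2) (lincombEw l3) scaler_sumr -big_split /=.
by apply: eq_bigr => i _; rewrite mcoeffD mcoeffZ scalerDl scalerA.
Qed.
HB.instance Definition _ :=
  GRing.isLinear.Build R {malg R[M]} V *:%R lincomb lincomb_is_linear.

Lemma lincombU i : lincomb << i >> = e i.
Proof.
by rewrite (lincombEw msuppU_le) big_seq_fset1 mcoeffUU scale1r.
Qed.

Lemma coordK he v : lincomb (coord he v) = v.
Proof. by rewrite -(eqP (xchooseP (he.1 v))). Qed.

Lemma lincombK he c : coord he (lincomb c) = c.
Proof.
by apply/eqP; rewrite -subr_eq0; apply/eqP/he.2; rewrite linearB /= coordK subrr.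
Qed.

Lemma coord_is_linear he : linear (coord he).
Proof.
move=> a u v; rewrite -[RHS](lincombK he) linearP /= !coordK //.
Qed.
HB.instance Definition _ he :=
  GRing.isLinear.Build R V {malg R[M]} *:%R (coord he) (coord_is_linear he).

Lemma coord_basis he i : coord he (e i) = << i >>.
Proof. by rewrite -lincombU lincombK. Qed.

End FreeModule.

(* The free module W on {fset M}; the parameter q, unused here, keys the
   q-dependent product on it.                                                *)
Definition WB (R : nzRingType) (d : Order.disp_t) (M : orderType d)
  (q : M -> R) : Type := {malg R[{fset M}]}.
Arguments WB {R d M} q.
HB.instance Definition _ (R : nzRingType) (d : Order.disp_t) (M : orderType d)
    (q : M -> R) :=
  GRing.Lmodule.copy (WB q) {malg R[{fset M}]}.

Section CliffordModel.
Context (R : comNzRingType) (d : Order.disp_t) (M : orderType d) (q : M -> R).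
Implicit Types (H J K : {fset M}).

Definition fsymd H J : {fset M} := (H `|` J) `\` (H `&` J).

Definition alpha H J : R := \prod_(i <- H) \prod_(j <- J | (j < i)%O) (-1).

Definition beta H J : R := \prod_(i <- H `&` J) q i.

Definition sigma H J : R := alpha H J * beta H J.

Local Notation WB := (WB q).

Definition eW H : WB := << H >>.

Definition wmul (u v : WB) : WB :=
  \sum_(H <- msupp u) \sum_(J <- msupp v)
    (u@_H * v@_J * sigma H J) *: eW (fsymd H J).

Lemma prod_fset_cond (f : M -> R) (D H : {fset M}) : H `<=` D ->
  \prod_(i <- H) f i = \prod_(i <- D) (if i \in H then f i else 1).
Proof.
move=> le; rewrite -[RHS](big_fset_incl _ le) => [|i _ /negbTE-> //].
by rewrite [LHS]big_seq [RHS]big_seq; apply: eq_bigr => i ->.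
Qed.

Lemma prod_fsymd (f : M -> R) H J : (forall i, f i * f i = 1) ->
  \prod_(i <- fsymd H J) f i = (\prod_(i <- H) f i) * \prod_(i <- J) f i.
Proof.
move=> ff; rewrite (prod_fset_cond f (fsubsetDl (H `|` J) (H `&` J))).
rewrite (prod_fset_cond f (fsubsetUl H J)) (prod_fset_cond f (fsubsetUr H J)).
rewrite -big_split /=; apply: eq_bigr => i _; rewrite !inE.
by case: (i \in H); case: (i \in J); rewrite /= ?ff ?mulr1 ?mul1r.
Qed.

Lemma prodN1_sqr (I : Type) (s : seq I) (P : pred I) :
  (\prod_(i <- s | P i) (-1 : R)) * \prod_(i <- s | P i) -1 = 1.
Proof. by rewrite -big_split /= big1 // => i _; rewrite mulrNN mulr1. Qed.

Lemma alphaDl H J K : alpha (fsymd H J) K = alpha H K * alpha J K.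
Proof. by apply: prod_fsymd => i; apply: prodN1_sqr. Qed.

Lemma alphaDr H J K : alpha H (fsymd J K) = alpha H J * alpha H K.
Proof.
rewrite /alpha -big_split /=; apply: eq_bigr => i _.
rewrite [LHS]big_mkcond prod_fsymd => [|j]; last first.
  by case: ifP; rewrite ?mulrNN mulr1.
by rewrite -!big_mkcond.
Qed.

Lemma beta_cocycle H J K :
  beta H J * beta (fsymd H J) K = beta H (fsymd J K) * beta J K.
Proof.
set D := H `|` (J `|` K).
have le (A B : {fset M}) : A `<=` D -> A `&` B `<=` D.
  by apply: fsubset_trans; apply: fsubsetIl.
have [hH hJ] : H `<=` D /\ J `<=` D.
  by split; apply/fsubsetP=> i; rewrite !inE => ->; rewrite ?orbT.
have hS : fsymd H J `<=` D.
  by apply/fsubsetP=> i; rewrite !inE => /andP[_ /orP[]->]; rewrite ?orbT.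
rewrite /beta (prod_fset_cond q (le _ J hH)) (prod_fset_cond q (le _ K hS)).
rewrite (prod_fset_cond q (le _ (fsymd J K) hH)) (prod_fset_cond q (le _ K hJ)).
rewrite -!big_split /=.
apply: eq_bigr => i _; rewrite !inE.
by case: (i \in H); case: (i \in J); case: (i \in K);
  rewrite /= ?mulr1 ?mul1r.
Qed.

Lemma sigma_cocycle H J K :
  sigma H J * sigma (fsymd H J) K = sigma H (fsymd J K) * sigma J K.
Proof.
rewrite /sigma mulrACA beta_cocycle alphaDl alphaDr.
by rewrite [RHS]mulrACA; congr (_ * _); rewrite -mulrA.
Qed.

Lemma fsymdA H J K : fsymd (fsymd H J) K = fsymd H (fsymd J K).
Proof.
apply/fsetP => i; rewrite !inE.
by case: (i \in H); case: (i \in J); case: (i \in K).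
Qed.

Lemma fsymd0f H : fsymd fset0 H = H.
Proof. by rewrite /fsymd fset0U fset0I fsetD0. Qed.

Lemma fsymdf0 H : fsymd H fset0 = H.
Proof. by rewrite /fsymd fsetU0 fsetI0 fsetD0. Qed.

Lemma sigma0f H : sigma fset0 H = 1.
Proof. by rewrite /sigma /alpha /beta fset0I !big_seq_fset0 mulr1. Qed.

Lemma sigmaf0 H : sigma H fset0 = 1.
Proof.
rewrite /sigma /alpha /beta fsetI0 big_seq_fset0 mulr1.
by rewrite big1 // => i _; rewrite big_nil.
Qed.

Lemma wmulEw (D E : {fset {fset M}}) (u v : WB) :
  msupp u `<=` D -> msupp v `<=` E ->
  wmul u v = \sum_(H <- D) \sum_(J <- E)
               (u@_H * v@_J * sigma H J) *: eW (fsymd H J).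
Proof.
move=> leD leE; rewrite /wmul [LHS](big_fset_incl _ leD) /=.
  apply: eq_bigr => H _; apply: big_fset_incl => // J _ /mcoeff_outdom->.
  by rewrite mulr0 mul0r scale0r.
move=> H _ /mcoeff_outdom uH; rewrite big1 // => J _.
by rewrite uH !mul0r scale0r.
Qed.

Lemma wmul_linearl v : linear (wmul^~ v).
Proof.
move=> a u1 u2; set D := msupp u1 `|` msupp u2.
have l1 : msupp u1 `<=` D by apply: fsubsetUl.
have l2 : msupp u2 `<=` D by apply: fsubsetUr.
have l3 : msupp (a *: u1 + u2) `<=` D.
  by apply: fsubset_trans (msuppD_le _ _) _; rewrite fsetSU // msuppZ_le.
rewrite (wmulEw l1 (fsubset_refl _)) (wmulEw l2 (fsubset_refl _)).
rewrite (wmulEw l3 (fsubset_refl _)) scaler_sumr -big_split /=.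
apply: eq_bigr => H _; rewrite scaler_sumr -big_split /=.
apply: eq_bigr => J _.
by rewrite mcoeffD mcoeffZ scalerA -scalerDl !mulrDl !mulrA.
Qed.

Lemma wmul_linearr u : linear (wmul u).
Proof.
move=> a u1 u2; set D := msupp u1 `|` msupp u2.
have l1 : msupp u1 `<=` D by apply: fsubsetUl.
have l2 : msupp u2 `<=` D by apply: fsubsetUr.
have l3 : msupp (a *: u1 + u2) `<=` D.
  by apply: fsubset_trans (msuppD_le _ _) _; rewrite fsetSU // msuppZ_le.
rewrite (wmulEw (fsubset_refl _) l1) (wmulEw (fsubset_refl _) l2).
rewrite (wmulEw (fsubset_refl _) l3) scaler_sumr -big_split /=.
apply: eq_bigr => H _; rewrite scaler_sumr -big_split /=.
apply: eq_bigr => J _.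
rewrite mcoeffD mcoeffZ scalerA -scalerDl mulrDr mulrDl !mulrA.
by rewrite (mulrC a).
Qed.

HB.instance Definition _ u :=
  GRing.isLinear.Build R WB WB *:%R (wmul u) (wmul_linearr u).

Let wmulr (v u : WB) := wmul u v.
Let wmulr_linear v : linear (wmulr v) := wmul_linearl v.
HB.instance Definition _ v :=
  GRing.isLinear.Build R WB WB *:%R (wmulr v) (wmulr_linear v).

Lemma wmulU H J : wmul (eW H) (eW J) = sigma H J *: eW (fsymd H J).
Proof.
rewrite (wmulEw msuppU_le msuppU_le) !big_seq_fset1 !mcoeffUU.
by rewrite !mul1r.
Qed.

Lemma WB_linear_ext (f g : {linear WB -> WB}) :
  (forall H, f (eW H) = g (eW H)) -> f =1 g.
Proof.
move=> fg u.
have -> : u = \sum_(H <- msupp u) u@_H *: eW H.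
  rewrite {1}[u]monalgE; apply: eq_bigr => H _; apply/malgP => K.
  by rewrite mcoeffZ !mcoeffU mulrnAr mulr1.
by rewrite !linear_sum; apply: eq_bigr => H _; rewrite !linearZ /= fg.
Qed.

Lemma wmul1 : left_id (eW fset0) wmul.
Proof.
move=> u; apply: (@WB_linear_ext (wmul (eW fset0)) idfun) => H /=.
by rewrite wmulU sigma0f fsymd0f scale1r.
Qed.

Lemma wmulr1 : right_id (eW fset0) wmul.
Proof.
move=> u; apply: (@WB_linear_ext (wmulr (eW fset0)) idfun) => H /=.
by rewrite /wmulr wmulU sigmaf0 fsymdf0 scale1r.
Qed.

Lemma wmulA : associative wmul.
Proof.
move=> u v w.
apply: (@WB_linear_ext (wmul u \o wmul v) (wmul (wmul u v))) => K /=.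
apply: (@WB_linear_ext (wmul u \o wmulr (eW K)) (wmulr (eW K) \o wmul u)) => J /=.
apply: (@WB_linear_ext (wmulr (wmul (eW J) (eW K)))
                (wmulr (eW K) \o wmulr (eW J))) => H /=.
rewrite {1}/wmulr {2}/wmulr !wmulU !linearZ /= /wmulr !wmulU.
by rewrite !scalerA fsymdA sigma_cocycle mulrC.
Qed.

Lemma eW0_neq0 : eW fset0 != 0.
Proof. by rewrite monalgU_eq0 oner_eq0. Qed.

Lemma wmulDl : left_distributive wmul +%R.
Proof. by move=> u v w; apply: (raddfD (wmulr w)). Qed.

Lemma wmulDr : right_distributive wmul +%R.
Proof. by move=> u v w; apply: (raddfD (wmul u)). Qed.

HB.instance Definition _ := GRing.Zmodule_isNzRing.Build WB
  wmulA wmul1 wmulr1 wmulDl wmulDr eW0_neq0.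

Lemma wscalerAl (a : R) (u v : WB) : a *: (u * v) = (a *: u) * v.
Proof. by rewrite [RHS](_ : _ = wmulr v (a *: u)) // linearZ. Qed.

Lemma wscalerAr (a : R) (u v : WB) : a *: (u * v) = u * (a *: v).
Proof. by rewrite [RHS](_ : _ = wmul u (a *: v)) // linearZ. Qed.

HB.instance Definition _ := GRing.Lmodule_isLalgebra.Build R WB wscalerAl.
HB.instance Definition _ := GRing.Lalgebra_isAlgebra.Build R WB wscalerAr.

Lemma eWM H J : eW H * eW J = sigma H J *: eW (fsymd H J).
Proof. exact: wmulU. Qed.

Lemma eW1 : eW fset0 = 1.
Proof. by []. Qed.

End CliffordModel.
Arguments eW {R d M} q H.

Section Clifford.
Context (R : comNzRingType) (V : lmodType R) (d : Order.disp_t).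
Context (M : orderType d) (e : M -> V) (he : is_basis e).
Context (B : {bilinear V -> V -> R | *%R & *%R}).

Definition qdiag (i : M) : R := B (e i) (e i).

(* The linear injection V -> W_B identifying e_i with e_{i}. *)
Definition inclW (v : V) : WB qdiag :=
  \sum_(i <- msupp (coord he v)) (coord he v)@_i *: eW qdiag [fset i].

Lemma inclWE v : inclW v = lincomb (fun i => eW qdiag [fset i]) (coord he v).
Proof. by []. Qed.

Lemma inclW_is_linear : linear inclW.
Proof. by move=> a u v; rewrite !inclWE !linearP. Qed.
HB.instance Definition _ :=
  GRing.isLinear.Build R V (WB qdiag) *:%R inclW inclW_is_linear.

Lemma inclW_basis i : inclW (e i) = eW qdiag [fset i].
Proof. by rewrite inclWE coord_basis lincombU. Qed.

Lemma inclW_inj : injective inclW.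
Proof.
move=> u v uv; rewrite -(coordK he u) -(coordK he v); congr lincomb.
have cE w i : (coord he w)@_i = mcoeff [fset i] (inclW w : {malg R[{fset M}]}).
  rewrite /inclW raddf_sum /=.
  have [iw|iw] := msuppP (coord he w) i; last first.
    rewrite big_seq big1 // => j jw; rewrite mcoeffZ mcoeffU.
    case: eqP => [/fset1_inj ji|_]; last by rewrite mulr0.
    by rewrite -ji jw in iw.
  rewrite (big_fsetD1 i) //= mcoeffZ mcoeffUU mulr1 big_seq big1 ?addr0 // => j.
  rewrite !inE => /andP[ji _]; rewrite mcoeffZ mcoeffU.
  by case: eqP => [/fset1_inj /eqP|_]; rewrite ?(negbTE ji) ?mulr0.
by apply/malgP => i; rewrite !cE uv.
Qed.

(* rho is the inclusion of V in C. *)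
Definition is_clifford (C : algType R) (rho : {linear V -> C}) : Prop :=
  injective rho /\
  exists2 phi : {lrmorphism C -> WB qdiag},
    bijective phi & forall v, phi (rho v) = inclW v.

Lemma WB_is_clifford : is_clifford inclW.
Proof.
by split; [exact: inclW_inj|exists idfun => //; exists idfun].
Qed.

End Clifford.

(* s makes the ring A an associative unital algebra over R.  The library's
   algType requires 1 != 0; the zero algebra is allowed here.  An algType R is
   the case s = *:%R.                                                        *)
Definition is_algebra (R : comNzRingType) (A : pzRingType) (s : R -> A -> A) :=
  [/\ forall a b x, s a (s b x) = s (a * b) x,
      forall x, s 1 x = x,
      (forall a x y, s a (x + y) = s a x + s a y) /\
        (forall a b x, s (a + b) x = s a x + s b x) &
      (forall a x y, s a (x * y) = s a x * y) /\
        (forall a x y, s a (x * y) = x * s a y)].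

Section Universal.
Context (R : comNzRingType) (V : lmodType R).
Context (B : {bilinear V -> V -> R | *%R & *%R}).

Definition in_AR (A : pzRingType) (s : R -> A -> A)
    (f : {linear V -> A | s}) : Prop :=
  forall x, f x ^+ 2 = s (B x x) 1.

Definition universal (U : algType R) (rho : {linear V -> U}) : Prop :=
  in_AR rho /\
  forall (A : pzRingType) (s : R -> A -> A) (f : {linear V -> A | s}),
    is_algebra s -> in_AR f ->
    exists2 F : {lrmorphism U -> A | s}, F \o rho =1 f &
      forall G : {lrmorphism U -> A | s}, G \o rho =1 f -> G =1 F.

End Universal.

Lemma algType_is_algebra (R : comNzRingType) (A : algType R) :
  is_algebra ( *:%R : R -> A -> A).
Proof.
split; first exact: scalerA.
- exact: scale1r.
- by split=> *; rewrite ?scalerDr ?scalerDl.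
- by split=> *; rewrite -?scalerAl -?scalerAr.
Qed.

(* Main.v *)
From HB Require Import structures.
Require Import Defs.
From mathcomp Require Import all_boot all_order ssralg sesquilinear.
From mathcomp Require Import finmap monalg.

(** In the model W_B, the basis vector e_K of a finite set K = {i_1 < ... < i_n}
is the product e_{i_1} ... e_{i_n} ([eW_monomial]): peeling off the least index
of K costs no sign, since no pair is out of order. Hence W_B is spanned by the
increasing monomials in the generators, and so is every Clifford algebra C.

Uniqueness follows at once: an algebra morphism is determined on the monomials
by its values on the generators, hence on V ([clifford_morphism_ext]).

For existence, let f be a map of A_R(V, B). Polarizing f(x)^2 = B(x, x) 1 shows
that the f(e_i) have squares q(i) and anticommute, because B is diagonal. The
only candidate is the linear map sending e_K to the increasing monomial in the
f(e_i) ([extension]). Multiplicativity need not be checked against the full sign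
alpha(H, J): as e_H is itself a product of generators, it suffices to multiply
by one generator e_i on the left. That case ([extension_gen_eW]) goes by
induction on K, removing its least element j: for i < j the new product is again
an increasing monomial, for i = j the square of e_i contracts, and for i > j the
two leading generators are exchanged at the price of a sign. The same relations
between generators hold on both sides, so the computations in W_B and in A run
in parallel.

It remains to see that V -> C lies in A_R(V, B), that is, that the relations on
the basis imply x^2 = B(x, x) 1 for every x. An expansion along sums requires
the cross terms xy + yx = (B(x, y) + B(y, x)) 1, which are bilinear in (x, y)
and are therefore checked on the basis first ([polar_from_basis],
[in_AR_from_basis]). This order of proof avoids any division by 2. *)

Set Implicit Arguments.
Unset Strict Implicit.
Unset Printing Implicit Defensive.

Import Order.TTheory GRing.Theory.
Local Open Scope fset_scope.
Local Open Scope ring_scope.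

(** * Finite subsets of a chain and increasing monomials *)

Section FiniteSubsets.
Context (d : Order.disp_t) (M : orderType d).
Implicit Types (i j : M) (K : {fset M}).

Definition min_lt j K := {in K, forall i, (j < i)%O}.

Lemma min_lt_notin j K : min_lt j K -> j \notin K.
Proof. by move=> jK; apply/negP => /jK; rewrite ltxx. Qed.

(** Induction along the increasing enumeration, from the largest element down,
so that each step adds a new first factor to an increasing product. *)
Lemma fset_min_ind (P : {fset M} -> Prop) :
  P fset0 -> (forall j K, min_lt j K -> P K -> P (j |` K)) -> forall K, P K.
Proof.
move=> P0 PS K; have -> : K = [fset i in sort <=%O K].
  by apply/fsetP => i; rewrite !inE mem_sort.
have : sorted <%O (sort <=%O K) by rewrite sort_lt_sorted fset_uniq.
elim: (sort _ _) => [_|j s IHs].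
  by rewrite (_ : [fset _ | _ in _] = fset0) //; apply/fsetP => i; rewrite !inE.
rewrite /= lt_path_sortedE => /andP[/allP js /IHs Ps].
have -> : [fset i in j :: s] = j |` [fset i in s].
  by apply/fsetP => i; rewrite !inE.
by apply: PS => // i; rewrite !inE; apply: js.
Qed.

Lemma sort_fsetU1 j K : min_lt j K -> sort <=%O (j |` K) = j :: sort <=%O K.
Proof.
move=> jK; apply: lt_sorted_eq => [||i].
- by rewrite sort_lt_sorted fset_uniq.
- rewrite /= lt_path_sortedE sort_lt_sorted fset_uniq andbT.
  by apply/allP => i; rewrite mem_sort => /jK.
- by rewrite inE !mem_sort !inE.
Qed.

Definition monomial (A : pzRingType) (g : M -> A) K : A :=
  \prod_(i <- sort <=%O K) g i.

Lemma monomial0 (A : pzRingType) (g : M -> A) : monomial g fset0 = 1.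
Proof. by rewrite /monomial big_nil. Qed.

Lemma monomialU1 (A : pzRingType) (g : M -> A) j K :
  min_lt j K -> monomial g (j |` K) = g j * monomial g K.
Proof. by move=> jK; rewrite /monomial sort_fsetU1 // big_cons. Qed.

Lemma rmorph_monomial (A A' : pzRingType) (F : {rmorphism A -> A'}) (g : M -> A)
  K : F (monomial g K) = monomial (F \o g) K.
Proof. by rewrite /monomial rmorph_prod. Qed.

End FiniteSubsets.

(** * Generators of the model *)

Section Model.
Context (R : comNzRingType) (d : Order.disp_t) (M : orderType d) (q : M -> R).
Implicit Types (i j : M) (K : {fset M}).

Local Notation gen i := (eW q [fset i]).

Lemma eW_expand (u : WB q) : u = \sum_(K <- msupp u) u@_K *: eW q K.
Proof.
rewrite {1}[u]monalgE; apply: eq_bigr => K _; apply/malgP => J.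
by rewrite [RHS]mcoeffZ [LHS]mcoeffU [X in _ * X]mcoeffU mulrnAr mulr1.
Qed.

(** No pair (j, i) with i in K is an inversion and j is not in K, so that
sigma({j}, K) = 1. *)
Lemma eWU1 j K : min_lt j K -> eW q (j |` K) = gen j * eW q K.
Proof.
move=> jK; have K0 : [fset j] `&` K = fset0.
  apply/fsetP => i; rewrite !inE; case: eqP => // ->.
  by apply/negbTE/min_lt_notin.
rewrite eWM /sigma /alpha /beta /fsymd K0 fsetD0 big_seq_fset0 mulr1.
rewrite big_seq_fset1 big_seq_cond big1 ?scale1r // => i /andP[/jK ji].
by rewrite ltNge (ltW ji).
Qed.

Lemma eW_monomial K : eW q K = monomial (fun i => gen i) K.
Proof.
elim/fset_min_ind: K => [|j K jK IH]; first by rewrite monomial0.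
by rewrite eWU1 // IH [RHS]monomialU1.
Qed.

Lemma gen_sqr i : gen i * gen i = q i *: 1.
Proof.
rewrite eWM /sigma /alpha /beta /fsymd fsetUid fsetIid fsetDv !big_seq_fset1.
by rewrite big_mkcond big_seq_fset1 ltxx mul1r.
Qed.

Lemma gen_anticomm i j : i != j -> gen i * gen j = - (gen j * gen i).
Proof.
wlog ij : i j / (i < j)%O => [th|_].
  case: (ltgtP i j) => // h _; first by apply: th; rewrite ?lt_eqF.
  by rewrite [X in - X]th ?opprK ?lt_eqF.
rewrite -eWU1 => [|k]; last by rewrite !inE => /eqP->.
rewrite eWM /sigma /alpha /beta.
have -> : [fset j] `&` [fset i] = fset0.
  apply/fsetP => k; rewrite !inE; case: eqP => // ->.
  by rewrite eq_sym (lt_eqF ij).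
rewrite big_seq_fset0 mulr1 big_seq_fset1 big_mkcond big_seq_fset1 ij.
rewrite scaleN1r opprK; congr (eW q _).
apply/fsetP => k; rewrite !inE.
by case: (eqVneq k i) => [->|]; rewrite ?(lt_eqF ij) ?andbF ?orbF.
Qed.

End Model.

(** * Target algebras as modules *)

Section ScaledAlgebra.
Context (R : comNzRingType) (A : pzRingType) (s : R -> A -> A).
Context (hs : is_algebra s).

(** A copy of A carrying the module structure given by s, so that linear
combinations are available. A may be the zero ring, hence the structure of a
nontrivial algebra cannot be used for it. *)
Definition scaled_alg of is_algebra s : Type := A.
Local Notation sA := (scaled_alg hs).

HB.instance Definition _ := GRing.PzRing.on sA.

Lemma scaled_scalerA a b (x : sA) : s a (s b x) = s (a * b) x.
Proof. by have [] := hs. Qed.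
Lemma scaled_scale1r : left_id 1 (s : R -> sA -> sA).
Proof. by have [] := hs. Qed.
Lemma scaled_scalerDr : right_distributive (s : R -> sA -> sA) +%R.
Proof. by have [_ _ []] := hs. Qed.
Lemma scaled_scalerDl (x : sA) : {morph (s : R -> sA -> sA)^~ x : a b / a + b}.
Proof. by have [_ _ [_ h] _] := hs => a b; apply: h. Qed.

HB.instance Definition _ := GRing.Zmodule_isLmodule.Build R sA
  scaled_scalerA scaled_scale1r scaled_scalerDr scaled_scalerDl.

Lemma scaled_scalerAl a (x y : sA) : a *: (x * y) = (a *: x) * y.
Proof. by have [_ _ _ []] := hs. Qed.
Lemma scaled_scalerAr a (x y : sA) : a *: (x * y) = x * (a *: y).
Proof. by have [_ _ _ []] := hs. Qed.

End ScaledAlgebra.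

(** * The morphism determined by images of the generators *)

Section Extension.
Context (R : comNzRingType) (A : pzRingType) (s : R -> A -> A).
Context (hs : is_algebra s).
Context (d : Order.disp_t) (M : orderType d) (q : M -> R).
Local Notation sA := (scaled_alg hs).
Context (g : M -> sA).
Hypothesis g_sqr : forall i, g i * g i = q i *: (1 : sA).
Hypothesis g_anticomm : forall i j, i != j -> g i * g j = - (g j * g i).

Definition extension (u : WB q) : sA :=
  lincomb (monomial g) (u : {malg R[{fset M}]}).

Lemma extension_is_linear : linear extension.
Proof. by move=> a u v; rewrite /extension linearP. Qed.
HB.instance Definition _ :=
  GRing.isLinear.Build R (WB q) sA *:%R extension extension_is_linear.

Lemma extensionZ a u : extension (a *: u) = a *: extension u.
Proof. exact: linearZ_LR. Qed.

Lemma extension_eW K : extension (eW q K) = monomial g K.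
Proof. exact: lincombU. Qed.

(** Multiplicativity for a left factor e_i, from which the general case follows
because the generators generate W_B. *)
Lemma extension_gen_eW i K :
  extension (eW q [fset i] * eW q K) = g i * monomial g K.
Proof.
elim/fset_min_ind: K i => [|j K jK IH] i.
  have l : min_lt i fset0 by move=> k; rewrite inE.
  by rewrite -eWU1 // extension_eW monomialU1.
have [ij|ji|->] := ltgtP i j.
- have l : min_lt i (j |` K).
    by move=> k; rewrite !inE => /orP[/eqP->//|/jK]; apply: lt_trans.
  by rewrite -eWU1 // extension_eW monomialU1.
- have ij : i != j by rewrite gt_eqF.
  (* The product e_i e_K is a multiple of the basis vector of {i} symdiff K, and
     j is still below that set: e_j can be put back in front. *)
  have l : min_lt j (fsymd [fset i] K).
    by move=> k; rewrite !inE => /andP[_ /orP[/eqP->//|/jK]].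
  rewrite monomialU1 // eWU1 // mulrA gen_anticomm // mulNr linearN /=.
  rewrite [RHS]mulrA g_anticomm // mulNr -[in RHS]mulrA -IH; congr (- _).
  rewrite -mulrA eWM -scalerAr [LHS]extensionZ [in RHS]extensionZ.
  rewrite -[RHS]scaled_scalerAr; congr (_ *: _).
  by rewrite -eWU1 // !extension_eW monomialU1.
- rewrite monomialU1 // eWU1 // mulrA gen_sqr [RHS]mulrA g_sqr.
  by rewrite -scalerAl -scaled_scalerAl !mul1r linearZ /= extension_eW.
Qed.

Lemma extension_gen i v : extension (eW q [fset i] * v) = g i * extension v.
Proof.
rewrite [v]eW_expand mulr_sumr !linear_sum mulr_sumr; apply: eq_bigr => K _ /=.
rewrite -scalerAr [LHS]extensionZ [in RHS]extensionZ extension_gen_eW.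
by rewrite -[RHS]scaled_scalerAr extension_eW.
Qed.

Lemma extensionM u v : extension (u * v) = extension u * extension v.
Proof.
rewrite [u]eW_expand mulr_suml !linear_sum mulr_suml; apply: eq_bigr => H _ /=.
rewrite -scalerAl [LHS]extensionZ [in RHS]extensionZ.
rewrite -[RHS]scaled_scalerAl; congr (_ *: _).
elim/fset_min_ind: H => [|j K jK IH].
  by rewrite extension_eW monomial0 !mul1r.
rewrite eWU1 // -(mulrA (eW q _)) [LHS]extension_gen [in RHS]extension_gen.
by rewrite IH [LHS]mulrA.
Qed.

Lemma extension1 : extension 1 = 1.
Proof. by rewrite -eW1 extension_eW monomial0. Qed.

End Extension.

(** * Squares and anticommutation *)

Lemma basis_ind (R : comNzRingType) (V : lmodType R) (M : choiceType)
    (e : M -> V) (he : is_basis e) (P : V -> Prop) :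
  P 0 -> (forall x y, P x -> P y -> P (x + y)) ->
  (forall a i, P (a *: e i)) -> forall x, P x.
Proof.
move=> P0 PD Pe x; rewrite -(coordK he x) /lincomb.
by apply: big_ind => // i _; apply: Pe.
Qed.

Section SquareFromBasis.
Context (R : comNzRingType) (V : lmodType R) (M : choiceType) (e : M -> V).
Hypothesis he : is_basis e.
Context (B : {bilinear V -> V -> R | *%R & *%R}).
Hypothesis hB : forall i j : M, i != j -> B (e i) (e j) = 0.
Context (A : algType R) (f : {linear V -> A}).
Hypothesis f_sqr : forall i, f (e i) * f (e i) = B (e i) (e i) *: 1.
Hypothesis f_anticomm :
  forall i j, i != j -> f (e i) * f (e j) = - (f (e j) * f (e i)).

(** Both sides are bilinear in (x, y). On the basis, the case of equal indices
is twice the square, and the case of distinct ones is anticommutation. *)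
Lemma polar_from_basis x y : f x * f y + f y * f x = (B x y + B y x) *: 1.
Proof.
elim/(basis_ind he): x => [|x x' Hx Hx'|a i].
- by rewrite linear0 linear0l linear0r mul0r mulr0 !addr0 scale0r.
- rewrite (linearD f) (linearDl B) (linearDr B) mulrDl mulrDr addrACA Hx Hx'.
  by rewrite -scalerDl addrACA.
elim/(basis_ind he): y => [|y y' Hy Hy'|b j].
- by rewrite linear0 linear0l linear0r mul0r mulr0 !addr0 scale0r.
- rewrite (linearD f) (linearDl B) (linearDr B) mulrDl mulrDr addrACA Hy Hy'.
  by rewrite -scalerDl addrACA.
rewrite !(linearZ_LR f) !(linearZl_LR B) !(linearZr_LR B) /=.
rewrite -!scalerAl -!scalerAr !scalerA.
have [->|ij] := eqVneq i j.
  by rewrite f_sqr !scalerA -scalerDl !mulrA (mulrC b a).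
rewrite f_anticomm // hB // hB 1?eq_sym // !mulr0 addr0 scale0r.
by rewrite scalerN (mulrC b) addNr.
Qed.

(** The squaring condition is not linear in x: its defect on a sum is the polar
identity. *)
Lemma in_AR_from_basis : in_AR B f.
Proof.
move=> x; elim/(basis_ind he): x => [|x y Hx Hy|a i].
- by rewrite linear0 expr0n linear0l scale0r.
- rewrite linearD (linearDl B) !(linearDr B) expr2 mulrDl !mulrDr -!expr2 Hx Hy.
  by rewrite addrA -(addrA (_ *: 1)) polar_from_basis -!scalerDl !addrA.
- rewrite (linearZ_LR f) (linearZl_LR B) (linearZr_LR B) /=.
  by rewrite expr2 -scalerAl -scalerAr f_sqr !scalerA mulrA.
Qed.

End SquareFromBasis.

Section Anticommutation.
Context (R : comNzRingType) (V : lmodType R).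
Context (B : {bilinear V -> V -> R | *%R & *%R}).
Context (A : pzRingType) (s : R -> A -> A) (hs : is_algebra s).
Context (f : {linear V -> A | s}).
Hypothesis hf : in_AR B f.

(** Polarization of the squaring condition at x + y. *)
Lemma in_AR_anticomm x y : B x y = 0 -> B y x = 0 -> f x * f y = - (f y * f x).
Proof.
move=> xy yx; have := hf (x + y).
rewrite raddfD (linearDl B) !(linearDr B) xy yx addr0 add0r.
have -> : s (B x x + B y y) 1 = s (B x x) 1 + s (B y y) 1.
  by have [_ _ [_ ->] _] := hs.
rewrite -!hf !expr2 mulrDl !mulrDr !addrA => /addIr.
by rewrite -addrA -[RHS]addr0 => /addrI/eqP; rewrite addr_eq0 => /eqP.
Qed.

End Anticommutation.

(** * Clifford algebras *)

Section CliffordAlgebra.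
Context (R : comNzRingType) (V : lmodType R) (d : Order.disp_t).
Context (M : orderType d) (e : M -> V) (he : is_basis e).
Context (B : {bilinear V -> V -> R | *%R & *%R}).
Context (C : algType R) (rho : {linear V -> C}).
Hypothesis hC : is_clifford he B rho.

(** The increasing monomials in the rho (e i) span C, since phi maps them to the
basis vectors of the model. *)
Lemma clifford_expand (phi : {lrmorphism C -> WB (qdiag e B)}) :
  injective phi -> (forall v, phi (rho v) = inclW he B v) ->
  forall c, c = \sum_(K <- msupp (phi c)) (phi c)@_K *: monomial (rho \o e) K.
Proof.
move=> phi_inj phi_rho c; apply: phi_inj; rewrite [LHS]eW_expand linear_sum.
apply: eq_bigr => K _; rewrite linearZ /= rmorph_monomial eW_monomial.
by congr (_ *: _); apply: eq_bigr => i _; rewrite /= phi_rho inclW_basis.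
Qed.

Lemma clifford_morphism_ext (A : pzRingType) (s : R -> A -> A)
    (F G : {lrmorphism C -> A | s}) :
  F \o rho =1 G \o rho -> F =1 G.
Proof.
have [_ [phi /bij_inj phi_inj phi_rho]] := hC => FG c.
rewrite (clifford_expand phi_inj phi_rho c) !raddf_sum.
apply: eq_bigr => K _ /=; rewrite (linearZ_LR F) (linearZ_LR G) /=.
by rewrite !rmorph_monomial; congr (s _ _); apply: eq_bigr => i _; apply: FG.
Qed.

Lemma clifford_in_AR :
  (forall i j : M, i != j -> B (e i) (e j) = 0) -> in_AR B rho.
Proof.
have [_ [phi /bij_inj phi_inj phi_rho]] := hC => hB.
apply: (in_AR_from_basis he hB) => [i|i j ij]; apply: phi_inj.
  by rewrite rmorphM /= phi_rho inclW_basis linearZ /= rmorph1 gen_sqr.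
by rewrite rmorphN /= !rmorphM /= !phi_rho !inclW_basis gen_anticomm.
Qed.

Lemma clifford_extend (A : pzRingType) (s : R -> A -> A)
    (f : {linear V -> A | s}) :
  (forall i j : M, i != j -> B (e i) (e j) = 0) ->
  is_algebra s -> in_AR B f ->
  exists F : {lrmorphism C -> A | s}, F \o rho =1 f.
Proof.
have [_ [phi _ phi_rho]] := hC => hB hs hf.
pose g : M -> scaled_alg hs := f \o e.
have g_sqr i : g i * g i = qdiag e B i *: (1 : scaled_alg hs) by apply: hf.
have g_anticomm i j : i != j -> g i * g j = - (g j * g i).
  by move=> ij; apply: (in_AR_anticomm hs hf); rewrite hB // eq_sym.
pose F0 (c : C) : A := extension g (phi c).
have F0_nmod : nmod_morphism F0.
  by split=> [|x y]; rewrite /F0 ?raddf0 ?raddfD.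
have F0_monoid : monoid_morphism F0.
  split=> [|x y]; first by rewrite /F0 rmorph1 extension1.
  by rewrite /F0 rmorphM /= extensionM.
have F0_scalable : scalable_for s F0.
  by move=> a x; rewrite /F0 linearZ /= extensionZ.
pose F : {lrmorphism C -> A | s} := HB.pack F0
  (Algebra.isNmodMorphism.Build _ _ F0 F0_nmod)
  (GRing.isMonoidMorphism.Build _ _ F0 F0_monoid)
  (GRing.isScalable.Build _ _ _ s F0 F0_scalable).
exists F => v; rewrite /= /F0 phi_rho /inclW -[in RHS](coordK he v) /lincomb.
rewrite (raddf_sum (extension g)) (raddf_sum f); apply: eq_bigr => i _ /=.
rewrite extensionZ extension_eW (linearZ_LR f).
by congr (s _ _); rewrite -(fsetU0 [fset i]) monomialU1 ?monomial0 ?mulr1.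
Qed.

End CliffordAlgebra.

Theorem corollary5 (R : comNzRingType) (V : lmodType R)
    (hV : exists v : V, v != 0)
    (d : Order.disp_t) (M : orderType d) (e : M -> V) (he : is_basis e)
    (B : {bilinear V -> V -> R | *%R & *%R})
    (hB : forall i j : M, i != j -> B (e i) (e j) = 0)
    (C : algType R) (rho : {linear V -> C})
    (hC : is_clifford he B rho) :
  universal B rho.
Proof.
split=> [|A s f hs hf]; first exact: clifford_in_AR hC hB.
have [F F_rho] := clifford_extend hC hB hs hf.
exists F => // G G_rho; apply: (clifford_morphism_ext hC) => v.
by rewrite G_rho F_rho.
Qed.
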